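(* Let a continuous, horizon-free mass function $m(r)$ be prescribed, with a flat cavity, a constant exterior value $M$, and enough differentiability in the matter region to define $\rho$. Among metrics of the form $$ds^2=-e^{2\Phi(r)}d\tau^2+\frac{dr^2}{1-2m(r)/r}+r^2d\Omega^2$$ normalized by $\Phi(\infty)=0$, imposing $p_r=0$ determines $\Phi$ uniquely by $$\Phi'=\frac{m}{r(r-2m)},\qquad\Phi(\infty)=0 .$$ Where the classical source is defined, its remaining components are necessarily $$\rho=\frac{m'}{4\pi r^2},\qquad p_\perp=\rho\,\frac{m}{2(r-2m)} .$$
   Context: Geometric units $G=c=1$. ''Horizon-free'' means $2m(r)<r$ for all $r>0$. ''Flat cavity'' means there is $L>0$ with $m(r)=0$ for $0\le r\le L$. ''Constant exterior value $M$'' means there is $R>L$ with $m(r)=M$ for $r\ge R$. The matter region is $L<r<R$, where $m$ is differentiable. $\Phi(\infty)=\lim_{r\to\infty}\Phi(r)$. The source is $T_{\mu\nu}=G_{\mu\nu}/(8\pi)$, diagonal in the static orthonormal frame, with energy density $\rho$, radial pressure $p_r$, and tangential pressure $p_\perp$ (both angular directions). With $f=1-2m/r$, the Einstein equations read $$8\pi\rho=\frac{2m'}{r^2},\qquad 8\pi p_r=-\frac{2m}{r^3}+\frac2r f\,\Phi',\qquad 8\pi p_\perp=f\Big(\Phi''+\Phi'^2+\frac{\Phi'}r\Big)+\frac{f'}2\Big(\Phi'+\frac1r\Big).$$ *)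

(* Defs.v *)
(* Stdlib reals with Coquelicot. *)
From Stdlib Require Import Reals.
From Coquelicot Require Import Coquelicot.

Open Scope R_scope.

(** Geometric units G = c = 1.  The metric
      ds^2 = - e^(2 Phi) dtau^2 + dr^2 / (1 - 2 m / r) + r^2 dOmega^2
    is parametrized by the pair [m Phi] of functions of the areal radius [r].
    Both are total functions on [R]; only the values of [m] on [0, oo) and
    those of [Phi] on (0, oo), the range of the radial coordinate, matter. *)

(** [L] is the radius of the flat cavity, [Rs] the outer radius of the matter
    region and [M] the exterior value.  Nothing is required of the derivative
    of [m] at [L] and [Rs], where it may fail to exist. *)
Record mass_profile (m : R -> R) (L Rs M : R) : Prop := {
  mass_continuous : continuous_on (fun r => 0 <= r) m;
  mass_horizon_free : forall r, 0 < r -> 2 * m r < r;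
  cavity_pos : 0 < L;
  mass_cavity : forall r, 0 <= r <= L -> m r = 0;
  matter_nonempty : L < Rs;
  mass_exterior : forall r, Rs <= r -> m r = M;
  mass_matter : forall r, L < r < Rs -> ex_derive m r
}.

(** Differentiability at every [r > 0] is what [radial_pressure] needs to be
    meaningful, since [Derive] is total. *)
Record normalized_potential (Phi : R -> R) : Prop := {
  potential_derivable : forall r, 0 < r -> ex_derive Phi r;
  potential_at_infinity : is_lim Phi p_infty 0
}.

Definition metric_f (m : R -> R) (r : R) : R := 1 - 2 * m r / r.

(** Components of the source T = G / (8 pi) in the static orthonormal frame,
    where T = diag (rho, p_r, p_perp, p_perp): the Einstein equations of the
    metric, solved for the source.  [radial_pressure] involves neither m' nor
    Phi'', so it makes sense at every radius. *)

Definition energy_density (m : R -> R) (r : R) : R :=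
  / (8 * PI) * (2 * Derive m r / r ^ 2).

Definition radial_pressure (m Phi : R -> R) (r : R) : R :=
  / (8 * PI) * (- (2 * m r / r ^ 3) + 2 / r * metric_f m r * Derive Phi r).

Definition tangential_pressure (m Phi : R -> R) (r : R) : R :=
  / (8 * PI) *
  (metric_f m r * (Derive_n Phi 2 r + Derive Phi r ^ 2 + Derive Phi r / r)
   + Derive (metric_f m) r / 2 * (Derive Phi r + 1 / r)).

Definition classical_source_defined (m Phi : R -> R) (r : R) : Prop :=
  ex_derive m r /\ ex_derive Phi r /\ ex_derive_n Phi 2 r.

(* Main.v *)
(** The radial pressure is an affine function of [Phi'] with slope proportional
    to [1 - 2m/r], which is nonzero without horizons, so [p_r = 0] prescribes
    [Phi'] pointwise by a continuous function and leaves one additive constant.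
    Where the mass is constant, [ln (1 - 2M/r) / 2] is a primitive, and it
    vanishes at infinity: this fixes the constant.  The tangential pressure
    follows by differentiating the formula for [Phi']. *)

Require Import Defs.
From Stdlib Require Import Reals Lra.
From Coquelicot Require Import Coquelicot.

Open Scope R_scope.

(** A function with zero derivative on [(0, oo)] keeps the value [d r] beyond [r], so its limit at
    infinity is both [d r] and 0. *)
Lemma derive_zero_lim_zero (d : R -> R) :
  (forall r, 0 < r -> is_derive d r 0) -> is_lim d p_infty 0 ->
  forall r, 0 < r -> d r = 0.
Proof.
intros Hd Hl r Hr.
assert (Hc : is_lim d p_infty (d r)).
{ apply is_lim_ext_loc with (f := fun _ => d r); [| apply is_lim_const].
  exists r; intros x Hx.
  apply (@eq_is_derive R_NormedModule d r x); [| exact Hx].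
  intros t Ht; apply Hd; lra. }
apply is_lim_unique in Hl; apply is_lim_unique in Hc.
rewrite Hl in Hc; injection Hc; intros E; now symmetry.
Qed.

Lemma normalized_potential_unique (Phi Psi g : R -> R) :
  normalized_potential Phi -> normalized_potential Psi ->
  (forall r, 0 < r -> is_derive Phi r (g r)) ->
  (forall r, 0 < r -> is_derive Psi r (g r)) ->
  forall r, 0 < r -> Psi r = Phi r.
Proof.
intros HPhi HPsi DPhi DPsi r Hr.
apply Rminus_diag_uniq.
apply (derive_zero_lim_zero (fun x => Psi x - Phi x)); [| | exact Hr].
- intros x Hx; replace 0 with (g x - g x) by ring.
  exact (is_derive_minus Psi Phi x _ _ (DPsi x Hx) (DPhi x Hx)).
- replace (Finite 0) with (Finite (0 - 0)) by (f_equal; ring).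
  apply is_lim_minus'; apply potential_at_infinity; assumption.
Qed.

Definition potential_slope (m : R -> R) (r : R) : R :=
  m r / (r * (r - 2 * m r)).

Lemma radial_pressure_eq0 (m Phi : R -> R) (r : R) :
  0 < r -> 2 * m r < r ->
  radial_pressure m Phi r = 0 <-> Derive Phi r = potential_slope m r.
Proof.
intros Hr Hm.
assert (Hpi := PI_RGT_0).
(* The affine dependence on [Phi'] in factored form; absence of a horizon makes the first factor
   positive. *)
assert (E : radial_pressure m Phi r =
  (r - 2 * m r) / (4 * PI * r ^ 2) * (Derive Phi r - potential_slope m r)).
{ unfold radial_pressure, metric_f, potential_slope; field.
  repeat split; lra. }
rewrite E; split; intros H.
- apply Rmult_integral in H; destruct H as [H | H]; [| lra].
  exfalso; revert H; apply Rgt_not_eq, Rdiv_lt_0_compat; [lra |].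
  apply Rmult_lt_0_compat; [lra | now apply pow_lt].
- rewrite H; ring.
Qed.

Lemma is_derive_potential_slope (m : R -> R) (r : R) :
  0 < r -> 2 * m r < r -> ex_derive m r ->
  is_derive (potential_slope m) r
    ((Derive m r * r ^ 2 - 2 * m r * r + 2 * m r ^ 2)
     / (r * (r - 2 * m r)) ^ 2).
Proof.
intros Hr Hm Dm; unfold potential_slope.
auto_derive.
- repeat split; try assumption.
  apply Rgt_not_eq, Rmult_lt_0_compat; lra.
- change (fun x => m x) with m; field; lra.
Qed.

Lemma Derive_metric_f (m : R -> R) (r : R) :
  0 < r -> ex_derive m r ->
  Derive (metric_f m) r = 2 * m r / r ^ 2 - 2 * Derive m r / r.
Proof.
intros Hr Dm; apply is_derive_unique; unfold metric_f.
auto_derive; [repeat split; try assumption; lra |].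
change (fun x => m x) with m; field; lra.
Qed.

Lemma continuous_potential_slope (m : R -> R) (r : R) :
  0 < r -> 2 * m r < r -> continuous m r -> continuous (potential_slope m) r.
Proof.
intros Hr Hm Cm; unfold potential_slope, Rdiv.
apply (continuous_mult m); [exact Cm |].
apply continuous_comp with (g := Rinv).
- apply (continuous_mult (fun x : R => x) (fun x => x - 2 * m x));
    [apply continuous_id |].
  apply (continuous_minus (fun x : R => x) (fun x => 2 * m x));
    [apply continuous_id |].
  apply (continuous_mult (fun _ : R => 2) m);
    [apply continuous_const | exact Cm].
- apply continuous_Rinv, Rgt_not_eq, Rmult_lt_0_compat; lra.
Qed.

(** The Schwarzschild potential: [exp (2 * Phi) = 1 - 2 * M / r] wherever the right-hand side is
    positive. *)
Definition vacuum_potential (M r : R) : R := ln (1 - 2 * M / r) / 2.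

Lemma is_derive_vacuum_potential (M r : R) :
  0 < r -> 2 * M < r ->
  is_derive (vacuum_potential M) r (M / (r * (r - 2 * M))).
Proof.
intros Hr HM; unfold vacuum_potential.
assert (Hf : 0 < 1 - 2 * M / r).
{ replace (1 - 2 * M / r) with ((r - 2 * M) / r) by (field; lra).
  apply Rdiv_lt_0_compat; lra. }
auto_derive; [repeat split; try assumption; lra |].
field; repeat split; lra.
Qed.

Lemma is_lim_vacuum_potential (M : R) :
  is_lim (vacuum_potential M) p_infty 0.
Proof.
assert (Hf : is_lim (fun r => 1 - 2 * M / r) p_infty 1).
{ replace (Finite 1) with (Finite (1 - 2 * M * 0)) by (f_equal; ring).
  apply is_lim_minus'; [apply is_lim_const |].
  apply (is_lim_scal_l Rinv (2 * M) p_infty 0).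
  apply (is_lim_inv (fun r => r) p_infty p_infty);
    [apply is_lim_id | discriminate]. }
assert (Hc : continuous (fun y => ln y / 2) 1).
{ apply (@ex_derive_continuous R_AbsRing R_NormedModule).
  auto_derive; lra. }
replace (Finite 0) with (Finite (ln 1 / 2))
  by (rewrite ln_1; f_equal; field).
exact (filterlim_comp _ _ _ _ (fun y => ln y / 2) _ _ _ Hf Hc).
Qed.

Section MassProfile.

Variables (m : R -> R) (L Rs M : R).
Hypothesis Hm : mass_profile m L Rs M.

(** The half-line [[0, oo)] is a neighbourhood of each [r > 0], so continuity relative to it is
    two-sided there. *)
Lemma mass_profile_continuous (r : R) : 0 < r -> continuous m r.
Proof.
intros Hr; apply (continuous_continuous_on (fun x => 0 <= x)).
- apply (filter_imp (fun x => 0 < x)); [| exact (open_gt 0 r Hr)].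
  intros x; apply Rlt_le.
- exact (mass_continuous _ _ _ _ Hm).
Qed.

Lemma radial_pressure_eq0_iff (Phi : R -> R) :
  (forall r, 0 < r -> ex_derive Phi r) ->
  (forall r, 0 < r -> radial_pressure m Phi r = 0) <->
  (forall r, 0 < r -> is_derive Phi r (potential_slope m r)).
Proof.
intros DPhi; split; intros H r Hr;
  assert (Hh := mass_horizon_free _ _ _ _ Hm r Hr).
- rewrite <- (proj1 (radial_pressure_eq0 m Phi r Hr Hh) (H r Hr)).
  now apply Derive_correct, DPhi.
- apply radial_pressure_eq0; try assumption.
  now apply is_derive_unique, H.
Qed.

(** The base point [Rs] is where the exterior begins, so the additive constant can be read off the
    explicit vacuum solution there. *)
Definition potential (r : R) : R :=
  vacuum_potential M Rs + RInt (potential_slope m) Rs r.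

Lemma outer_radius_pos : 0 < Rs.
Proof.
assert (H1 := cavity_pos _ _ _ _ Hm).
assert (H2 := matter_nonempty _ _ _ _ Hm); lra.
Qed.

(** The fundamental theorem of calculus: the slope involves [m] but not [m'], hence is continuous
    even across [L] and [Rs]. *)
Lemma is_derive_potential (r : R) :
  0 < r -> is_derive potential r (potential_slope m r).
Proof.
intros Hr; assert (HR := outer_radius_pos).
assert (Hc : forall x, 0 < x -> continuous (potential_slope m) x).
{ intros x Hx; apply continuous_potential_slope; [exact Hx | |].
  - now apply (mass_horizon_free _ _ _ _ Hm).
  - now apply mass_profile_continuous. }
replace (potential_slope m r) with (0 + potential_slope m r) by ring.
apply (is_derive_plus (fun _ => vacuum_potential M Rs)
         (RInt (potential_slope m) Rs)); [apply @is_derive_const |].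
apply (is_derive_RInt _ _ Rs); [| now apply Hc].
apply (filter_imp (fun x => 0 < x)); [| exact (open_gt 0 r Hr)].
intros x Hx; apply (@RInt_correct R_CompleteNormedModule),
  (@ex_RInt_continuous R_CompleteNormedModule).
(* The integration segment joins two positive radii, so it stays away from the origin, also when
   [x < Rs]. *)
intros z [Hz _]; apply Hc.
apply Rlt_le_trans with (2 := Hz); now apply Rmin_glb_lt.
Qed.

(** Both sides agree at [Rs], where the integral is empty, and have the same derivative beyond it
    because [m = M] there. *)
Lemma potential_exterior (r : R) :
  Rs <= r -> potential r = vacuum_potential M r.
Proof.
intros Hr; assert (HR := outer_radius_pos).
(* The constancy argument needs a nondegenerate interval; [r = Rs] is the empty integral. *)
destruct Hr as [Hr | <-].
2: { unfold potential; rewrite RInt_point; apply Rplus_0_r. }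
assert (E : potential r - vacuum_potential M r =
            potential Rs - vacuum_potential M Rs).
{ symmetry; apply (@eq_is_derive R_NormedModule
    (fun x => potential x - vacuum_potential M x)); [| exact Hr].
  intros t Ht; assert (Ht0 : 0 < t) by lra.
  assert (Hmt := mass_exterior _ _ _ _ Hm t (proj1 Ht)).
  assert (Hh := mass_horizon_free _ _ _ _ Hm t Ht0); rewrite Hmt in Hh.
  replace (@zero R_NormedModule)
    with (potential_slope m t - M / (t * (t - 2 * M)))
    by (unfold potential_slope; rewrite Hmt; apply Rminus_diag_eq; reflexivity).
  exact (is_derive_minus potential (vacuum_potential M) t _ _
           (is_derive_potential t Ht0)
           (is_derive_vacuum_potential M t Ht0 Hh)). }
unfold potential at 2 in E; rewrite RInt_point in E.
unfold zero in E; simpl in E; lra.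
Qed.

Lemma normalized_potential_potential : normalized_potential potential.
Proof.
split.
- intros r Hr; eexists; now apply is_derive_potential.
- apply is_lim_ext_loc with (f := vacuum_potential M).
  + exists Rs; intros x Hx; symmetry; now apply potential_exterior, Rlt_le.
  + apply is_lim_vacuum_potential.
Qed.

(** [Derive Phi] coincides with the slope on a neighbourhood of [r], so differentiability of [m] at
    the single point [r] already yields [Phi''] there. *)
Lemma is_derive_Derive_potential (Phi : R -> R) (r : R) :
  (forall x, 0 < x -> is_derive Phi x (potential_slope m x)) ->
  0 < r -> ex_derive m r ->
  is_derive (Derive Phi) r
    ((Derive m r * r ^ 2 - 2 * m r * r + 2 * m r ^ 2)
     / (r * (r - 2 * m r)) ^ 2).
Proof.
intros DPhi Hr Dm.
apply is_derive_ext_loc with (f := potential_slope m).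
- apply (filter_imp (fun x => 0 < x)); [| exact (open_gt 0 r Hr)].
  intros x Hx; symmetry; now apply is_derive_unique, DPhi.
- apply is_derive_potential_slope; try assumption.
  now apply (mass_horizon_free _ _ _ _ Hm).
Qed.

(** After substitution the terms free of [m'] cancel: the [f] part contributes
    [(m^2 - m r) / (r^3 (r - 2 m))] and the [f'] part its opposite. The terms in [m'] add up to
    [m m' / (r^2 (r - 2 m))], which is [8 PI rho] times [m / (2 (r - 2 m))]. *)
Lemma tangential_pressure_eq (Phi : R -> R) (r : R) :
  (forall x, 0 < x -> is_derive Phi x (potential_slope m x)) ->
  0 < r -> ex_derive m r ->
  tangential_pressure m Phi r =
    energy_density m r * (m r / (2 * (r - 2 * m r))).
Proof.
intros DPhi Hr Dm.
assert (Hh := mass_horizon_free _ _ _ _ Hm r Hr).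
assert (Hpi := PI_RGT_0).
unfold tangential_pressure, energy_density.
change (Derive_n Phi 2 r) with (Derive (Derive Phi) r).
rewrite (is_derive_unique _ _ _ (is_derive_Derive_potential Phi r DPhi Hr Dm)).
rewrite (is_derive_unique _ _ _ (DPhi r Hr)), (Derive_metric_f m r Hr Dm).
unfold metric_f, potential_slope; field; repeat split; lra.
Qed.

End MassProfile.

Theorem proposition7 (m : R -> R) (L Rs M : R) (Hm : mass_profile m L Rs M) :
  (forall Phi : R -> R, normalized_potential Phi ->
     ((forall r, 0 < r -> radial_pressure m Phi r = 0) <->
      (forall r, 0 < r -> is_derive Phi r (m r / (r * (r - 2 * m r))))))
  /\
  (exists Phi : R -> R,
     normalized_potential Phi /\
     (forall r, 0 < r -> radial_pressure m Phi r = 0) /\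
     (forall Psi : R -> R,
        normalized_potential Psi ->
        (forall r, 0 < r -> radial_pressure m Psi r = 0) ->
        forall r, 0 < r -> Psi r = Phi r))
  /\
  (forall Phi : R -> R,
     normalized_potential Phi ->
     (forall r, 0 < r -> radial_pressure m Phi r = 0) ->
     (forall r, 0 < r -> ex_derive m r -> classical_source_defined m Phi r) /\
     (forall r, 0 < r -> classical_source_defined m Phi r ->
        energy_density m r = Derive m r / (4 * PI * r ^ 2) /\
        tangential_pressure m Phi r =
          energy_density m r * (m r / (2 * (r - 2 * m r))))).
Proof.
assert (Hiff : forall Phi, normalized_potential Phi ->
  ((forall r, 0 < r -> radial_pressure m Phi r = 0) <->
   (forall r, 0 < r -> is_derive Phi r (potential_slope m r)))).
{ intros Phi HPhi; apply (radial_pressure_eq0_iff m L Rs M Hm).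
  exact (potential_derivable _ HPhi). }
assert (Hpot := normalized_potential_potential m L Rs M Hm).
assert (Dpot := is_derive_potential m L Rs M Hm).
split; [exact Hiff | split].
- exists (potential m Rs M); split; [exact Hpot | split].
  + now apply Hiff.
  + intros Psi HPsi Hp.
    apply (normalized_potential_unique _ _ (potential_slope m));
      try assumption.
    now apply Hiff.
- intros Phi HPhi Hp.
  assert (DPhi := proj1 (Hiff Phi HPhi) Hp).
  split.
  + intros r Hr Dm; split; [exact Dm | split].
    * now apply potential_derivable.
    (* Second differentiability of [Phi] is not assumed; the equation for [Phi'] supplies it
       wherever [m'] exists. *)
    * eexists; exact (is_derive_Derive_potential m L Rs M Hm Phi r DPhi Hr Dm).
  + intros r Hr [Dm _]; split.
    * assert (Hpi := PI_RGT_0).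
      unfold energy_density; field; lra.
    * now apply (tangential_pressure_eq m L Rs M Hm).
Qed.
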